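(* Let $\mu$ and $\lambda$ be two complex parameters. Then for all integers $n\ge1$, $$\begin{aligned}\sum_{k=0}^n\binom{n}{k}\left\lfloor\frac{k}{2}\right\rfloor\mu^k\lambda^{n-k}H_k&=\frac{n\mu}{2}(\lambda+\mu)^{n-1}\left(H_n-\sum_{k=1}^{n-1}\frac1k\left(\frac{\lambda}{\lambda+\mu}\right)^k\right)-\frac{\lambda}{2}\left(\lambda^{n-1}-(\lambda+\mu)^{n-1}\right)\\&\quad-\frac14\left((\lambda+\mu)^n-(\lambda-\mu)^n\right)H_n+\frac14\sum_{k=1}^n\frac{\lambda^k}{k}\left((\lambda+\mu)^{n-k}-(\lambda-\mu)^{n-k}\right),\end{aligned}$$ where, when $\lambda+\mu=0$, each product $(\lambda+\mu)^{n-1}\left(\frac{\lambda}{\lambda+\mu}\right)^k$ with $1\le k\le n-1$ is read as $\lambda^k(\lambda+\mu)^{n-1-k}$.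
   Context: $\lfloor x\rfloor$ denotes the floor function. $H_n$ are the harmonic numbers: $H_0=0$ and $H_n=\sum_{k=1}^n\frac1k$ for $n\ge1$. Conventions: $0^0=1$, and $\sum_{k=m}^n s_k=0$ if $n<m$. *)

(* Defs.v *)
From mathcomp Require Import all_boot all_order all_algebra.
From mathcomp Require Import reals complex.

Set Implicit Arguments.
Unset Strict Implicit.
Unset Printing Implicit Defensive.

Import Order.TTheory GRing.Theory Num.Theory.
Local Open Scope ring_scope.

Definition harmonic_number (F : fieldType) (n : nat) : F :=
  \sum_(1 <= k < n.+1) k%:R^-1.

(* (l + m)^(n-1) * (H_n - sum_(1 <= k <= n-1) (l / (l + m))^k / k).
   When l + m = 0 the outer power is distributed over the bracket and each
   product (l + m)^(n-1) * (l / (l + m))^k is read as l^k * (l + m)^(n-1-k). *)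
Definition harmonic_bracket (F : fieldType) (l m : F) (n : nat) : F :=
  if l + m == 0 then
    (l + m) ^+ (n - 1) * harmonic_number F n
    - \sum_(1 <= k < n) k%:R^-1 * (l ^+ k * (l + m) ^+ (n - 1 - k))
  else
    (l + m) ^+ (n - 1)
    * (harmonic_number F n - \sum_(1 <= k < n) k%:R^-1 * (l / (l + m)) ^+ k).

(* Main.v *)
Require Import Defs.
From mathcomp Require Import all_boot all_order all_algebra.
From mathcomp Require Import reals complex.
From mathcomp Require Import ring.

Set Implicit Arguments.
Unset Strict Implicit.
Unset Printing Implicit Defensive.

Import Order.TTheory GRing.Theory Num.Theory.
Local Open Scope ring_scope.

(** Since [floor (k / 2) = k / 2 - (1 - (-1) ^ k) / 4], the left-hand side is a
    combination of three binomial sums: the harmonic sum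
    [A_n (l, m) = sum_k C(n, k) m^k l^(n-k) H_k], the same sum at [(l, -m)], and
    the harmonic sum with the extra weight [k].

    Two facts about an arbitrary weight [f] evaluate all of them: Pascal's rule
    ([binom_sumS]) and absorption, [k C(n, k) = n C(n-1, k-1)] ([binom_sum_mul]).
    Pascal's rule together with [H_(k+1) = H_k + 1 / (k+1)] gives
    [A_(n+1) = (l + m) A_n + m sum_k C(n, k) m^k l^(n-k) / (k+1)], where
    absorption turns the last term into
    [((l + m)^(n+1) - l^(n+1)) / (n+1)]; unrolling this recurrence yields
    [A_n = (l + m)^n H_n - sum_(1 <= k <= n) l^k (l + m)^(n-k) / k]
    ([binom_sum_harmonic]).  Absorption also reduces the sum weighted by
    [k H_k] to [A_(n-1)] ([binom_sum_mul_harmonic]), and [A_(n-1)] is the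
    harmonic bracket minus the single term [(l + m)^(n-1) / n]. *)

(** * Weighted binomial sums *)

Definition binom_sum (F : fieldType) (l m : F) (f : nat -> F) (n : nat) : F :=
  \sum_(0 <= k < n.+1) 'C(n, k)%:R * m ^+ k * l ^+ (n - k) * f k.

Section BinomSum.

Variables (F : numFieldType) (l m : F).
Implicit Types (f g : nat -> F) (n : nat).

Lemma eq_binom_sum f g n : f =1 g -> binom_sum l m f n = binom_sum l m g n.
Proof. by move=> fg; apply: eq_bigr => k _; rewrite fg. Qed.

Lemma binom_sumD f g n :
  binom_sum l m (fun k => f k + g k) n = binom_sum l m f n + binom_sum l m g n.
Proof. by rewrite -big_split /=; apply: eq_bigr => k _; rewrite mulrDr. Qed.

Lemma binom_sumZ a f n :
  binom_sum l m (fun k => a * f k) n = a * binom_sum l m f n.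
Proof. by rewrite big_distrr /=; apply: eq_bigr => k _; rewrite mulrCA. Qed.

Lemma binom_sum_sign f n :
  binom_sum l m (fun k => (-1) ^+ k * f k) n = binom_sum l (- m) f n.
Proof. by apply: eq_bigr => k _; rewrite (exprNn m); ring. Qed.

Lemma binom_sum1 n : binom_sum l m (fun=> 1) n = (l + m) ^+ n.
Proof.
rewrite exprDn /binom_sum big_mkord; apply: eq_bigr => k _.
by rewrite -mulr_natr; ring.
Qed.

Lemma binom_sum_pos n :
  binom_sum l m (fun k => (k != 0)%:R) n = (l + m) ^+ n - l ^+ n.
Proof.
rewrite -binom_sum1 /binom_sum !(big_nat_recl n) //= bin0 subn0.
by rewrite expr0 !mul1r mulr0 mulr1 add0r addrC addKr.
Qed.

(** Pascal's rule splits [C(n+1, k+1)]: the part [C(n, k+1)] keeps the weight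
    and leaves a spare [l], the part [C(n, k)] shifts it and leaves a spare
    [m]. *)
Lemma binom_sumS f n :
  binom_sum l m f n.+1 =
  l * binom_sum l m f n + m * binom_sum l m (fun k => f k.+1) n.
Proof.
have -> : l * binom_sum l m f n =
    l ^+ n.+1 * f 0
    + \sum_(0 <= k < n.+1) 'C(n, k.+1)%:R * m ^+ k.+1 * l ^+ (n - k) * f k.+1.
  (* the term k = n of the shifted sum vanishes, as C(n, n + 1) = 0 *)
  rewrite [in RHS]big_nat_recr //= bin_small // !mul0r addr0.
  rewrite /binom_sum big_nat_recl // bin0 subn0 mulrDr big_distrr /=.
  congr (_ + _); first by rewrite exprS; ring.
  apply: eq_big_nat => k /andP[_ kn].
  by rewrite -(subnSK kn) (exprS l); ring.
rewrite /binom_sum big_nat_recl // bin0 subn0 big_distrr -addrA -big_split /=.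
congr (_ + _); first by ring.
apply: eq_bigr => k _.
by rewrite binS natrD subSS exprS; ring.
Qed.

(** The absorption identity [k C(n+1, k) = (n+1) C(n, k-1)], which removes a
    factor [k] from the weight at the price of a shift. *)
Lemma binom_sum_mul f n :
  binom_sum l m (fun k => k%:R * f k) n.+1 =
  n.+1%:R * m * binom_sum l m (fun k => f k.+1) n.
Proof.
rewrite /binom_sum big_nat_recl // mul0r mulr0 add0r big_distrr /=.
apply: eq_bigr => k _; rewrite subSS exprS.
have absorb : k.+1%:R * 'C(n.+1, k.+1)%:R = n.+1%:R * 'C(n, k)%:R :> F.
  by rewrite -!natrM mul_bin_diag.
transitivity ((k.+1%:R * 'C(n.+1, k.+1)%:R) *
              (m * m ^+ k * l ^+ (n - k) * f k.+1)); first by ring.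
by rewrite absorb; ring.
Qed.

(** Absorption applied to the weight [1 / k], whose product with [k] is 1
    except at [k = 0]. *)
Lemma binom_sum_inv n :
  m * binom_sum l m (fun k => k.+1%:R^-1) n =
  ((l + m) ^+ n.+1 - l ^+ n.+1) / n.+1%:R.
Proof.
have n_neq0 : n.+1%:R != 0 :> F by rewrite pnatr_eq0.
apply: (canRL (mulfK n_neq0)).
rewrite -binom_sum_pos mulrC mulrA -(binom_sum_mul (fun k => k%:R^-1)).
apply: eq_binom_sum => -[|k]; first by rewrite mul0r.
by rewrite mulfV // pnatr_eq0.
Qed.

(** * Harmonic binomial sums *)

Lemma harmonic_numberS n :
  harmonic_number F n.+1 = harmonic_number F n + n.+1%:R^-1.
Proof. by rewrite /harmonic_number big_nat_recr. Qed.

Lemma binom_sum_harmonicS n :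
  binom_sum l m (harmonic_number F) n.+1 =
  (l + m) * binom_sum l m (harmonic_number F) n
  + ((l + m) ^+ n.+1 - l ^+ n.+1) / n.+1%:R.
Proof.
rewrite binom_sumS (eq_binom_sum n harmonic_numberS) binom_sumD mulrDr.
by rewrite binom_sum_inv (mulrDl l m) addrA.
Qed.

Lemma binom_sum_harmonic n :
  binom_sum l m (harmonic_number F) n =
  (l + m) ^+ n * harmonic_number F n
  - \sum_(1 <= k < n.+1) l ^+ k / k%:R * (l + m) ^+ (n - k).
Proof.
elim: n => [|n IHn].
  by rewrite /binom_sum big_nat1 /harmonic_number !big_geq // !mulr0 subr0.
rewrite binom_sum_harmonicS IHn [in RHS]big_nat_recr //= subnn harmonic_numberS.
have -> : \sum_(1 <= k < n.+1) l ^+ k / k%:R * (l + m) ^+ (n.+1 - k) =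
    (l + m) * \sum_(1 <= k < n.+1) l ^+ k / k%:R * (l + m) ^+ (n - k).
  rewrite big_distrr; apply: eq_big_nat => k /andP[_ kn] /=.
  by rewrite subSn // exprS mulrCA.
by rewrite (exprS (l + m)); ring.
Qed.

Lemma binom_sum_mul_harmonic n :
  binom_sum l m (fun k => k%:R * harmonic_number F k) n.+1 =
  n.+1%:R * m * binom_sum l m (harmonic_number F) n
  + ((l + m) ^+ n.+1 - l ^+ n.+1).
Proof.
rewrite binom_sum_mul (eq_binom_sum n harmonic_numberS) binom_sumD mulrDr.
congr (_ + _); rewrite -mulrA binom_sum_inv mulrC mulfVK //.
by rewrite pnatr_eq0.
Qed.

(** Distributing the outer power makes the two cases of the bracket agree; the
    last term comes from [H_(n+1) = H_n + 1 / (n+1)]. *)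
Lemma harmonic_bracketE n :
  harmonic_bracket l m n.+1 =
  binom_sum l m (harmonic_number F) n + (l + m) ^+ n / n.+1%:R.
Proof.
rewrite binom_sum_harmonic addrAC -mulrDr -harmonic_numberS /harmonic_bracket.
rewrite subn1 /=; case: eqVneq => [_ | s_neq0].
  by congr (_ - _); apply: eq_bigr => k _; ring.
rewrite mulrBr; congr (_ - _); rewrite big_distrr.
apply: eq_big_nat => k /andP[k_gt0 kn] /=.
rewrite expr_div_n -{1}(subnK (kn : (k <= n)%N)) exprD.
by field; rewrite pnatr_eq0 -lt0n k_gt0 expf_neq0.
Qed.

(** * The floor weight *)

Lemma natr_half k : (k./2)%:R = k%:R / 2 - (1 - (-1) ^+ k) / 4 :> F.
Proof.
rewrite -{2}(odd_double_half k) -signr_odd natrD -muln2 natrM.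
by case: (odd k) => /=; field.
Qed.

Lemma binom_sum_half_harmonic n :
  binom_sum l m (fun k => (k./2)%:R * harmonic_number F k) n =
  1 / 2 * binom_sum l m (fun k => k%:R * harmonic_number F k) n
  - 1 / 4 * (binom_sum l m (harmonic_number F) n
             - binom_sum l (- m) (harmonic_number F) n).
Proof.
rewrite -binom_sum_sign.
transitivity (binom_sum l m (fun k =>
    1 / 2 * (k%:R * harmonic_number F k)
    + (- (1 / 4) * harmonic_number F k
       + 1 / 4 * ((-1) ^+ k * harmonic_number F k))) n).
  by apply: eq_binom_sum => k; rewrite natr_half; field.
by rewrite !binom_sumD !binom_sumZ; ring.
Qed.

End BinomSum.

Lemma floor_half (R : realType) (k : nat) : Num.floor (k%:R / 2 : R) = k./2.
Proof.
apply: floor_def; rewrite intrD -pmulrn natr1.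
rewrite ler_pdivlMr ?ltr_pdivrMr // -!natrM ler_nat ltr_nat.
rewrite !muln2 doubleS -{2 3}(odd_double_half k) leq_addl.
by case: (odd k); rewrite ?add1n ?add0n /= ?ltnS ?leqnSn.
Qed.

Theorem proposition6 (R : realType) (mu lambda : R[i]%C) (n : nat)
    (hn : (1 <= n)%N) :
  \sum_(0 <= k < n.+1)
     'C(n, k)%:R * (Num.floor (k%:R / 2 : R))%:~R
     * mu ^+ k * lambda ^+ (n - k) * harmonic_number R[i]%C k
  = n%:R * mu / 2 * harmonic_bracket lambda mu n
    - lambda / 2 * (lambda ^+ (n - 1) - (lambda + mu) ^+ (n - 1))
    - 1 / 4 * ((lambda + mu) ^+ n - (lambda - mu) ^+ n)
      * harmonic_number R[i]%C n
    + 1 / 4 * \sum_(1 <= k < n.+1)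
        lambda ^+ k / k%:R
        * ((lambda + mu) ^+ (n - k) - (lambda - mu) ^+ (n - k)).
Proof.
case: n hn => // n _.
transitivity (binom_sum lambda mu
    (fun k => (k./2)%:R * harmonic_number R[i]%C k) n.+1).
  by apply: eq_bigr => k _; rewrite floor_half -pmulrn; ring.
have -> : \sum_(1 <= k < n.+2) lambda ^+ k / k%:R *
      ((lambda + mu) ^+ (n.+1 - k) - (lambda - mu) ^+ (n.+1 - k)) =
    \sum_(1 <= k < n.+2) lambda ^+ k / k%:R * (lambda + mu) ^+ (n.+1 - k)
    - \sum_(1 <= k < n.+2) lambda ^+ k / k%:R * (lambda - mu) ^+ (n.+1 - k).
  by rewrite -sumrB; apply: eq_bigr => k _; rewrite mulrBr.
rewrite binom_sum_half_harmonic binom_sum_mul_harmonic harmonic_bracketE.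
rewrite !(binom_sum_harmonic _ _ n.+1) subn1 /= !exprS.
by field; rewrite nat1r pnatr_eq0.
Qed.
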